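(* Let $G$ and $H$ be graphs, each with the constant threshold $t\ge 3$, such that $dyn_t(G)\le dyn_t(H)$. Let $D_H$ be a minimum $t$-dynamic monopoly of $H$ such that the induced subgraph $H[D_H]$ has no isolated vertex. Then $dyn_t(G\Box H)\le dyn_t(G)\cdot dyn_t(H)-\dfrac12 dyn_t(H)$.
   Context: $G\Box H$ is the Cartesian product (vertex set $V(G)\times V(H)$, $(u,v)\sim(u',v')$ iff $u=u'$ and $vv'\in E(H)$, or $v=v'$ and $uu'\in E(G)$), also with constant threshold $t$. Thresholds are assumed not to exceed vertex degrees. A set $D$ of vertices is a $t$-dynamic monopoly if starting from $D$ and repeatedly adding any vertex having at least $t$ neighbors in the current set eventually yields all vertices; $dyn_t$ is the minimum size of a $t$-dynamic monopoly. $H[S]$ denotes the subgraph induced by $S$. *)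

(* Defs.v *)
From HB Require Import structures.
From mathcomp Require Import all_boot all_order all_algebra.

Set Implicit Arguments.
Unset Strict Implicit.
Unset Printing Implicit Defensive.

Record sgraph := SGraph {
  vertex :> finType;
  adj : rel vertex;
  adj_sym : symmetric adj;
  adj_irrefl : irreflexive adj
}.

Definition nbhd (G : sgraph) (v : G) : {set G} := [set u | adj v u].

Definition degree (G : sgraph) (v : G) : nat := #|nbhd v|.

Definition isolated (G : sgraph) (v : G) : bool := degree v == 0.

Section CartesianProduct.

Variables G H : sgraph.

Definition cart_adj : rel (G * H) := fun x y =>
  ((x.1 == y.1) && adj x.2 y.2) || ((x.2 == y.2) && adj x.1 y.1).

Lemma cart_adj_sym : symmetric cart_adj.
Proof.
move=> x y; rewrite /cart_adj (eq_sym x.1) (eq_sym x.2).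
by rewrite (adj_sym x.1) (adj_sym x.2).
Qed.

Lemma cart_adj_irrefl : irreflexive cart_adj.
Proof. by move=> x; rewrite /cart_adj !adj_irrefl !andbF. Qed.

Definition cart_prod : sgraph := SGraph cart_adj_sym cart_adj_irrefl.

End CartesianProduct.

Notation "G □ H" := (cart_prod G H) (at level 40, left associativity).

Section InducedSubgraph.

Variables (G : sgraph) (S : {set G}).

Definition induced_adj : rel {x : G | x \in S} :=
  fun x y => adj (val x) (val y).

Lemma induced_adj_sym : symmetric induced_adj.
Proof. by move=> x y; apply: adj_sym. Qed.

Lemma induced_adj_irrefl : irreflexive induced_adj.
Proof. by move=> x; apply: adj_irrefl. Qed.

Definition induced : sgraph := SGraph induced_adj_sym induced_adj_irrefl.

End InducedSubgraph.

Section DynamicMonopolies.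

Variables (t : nat) (G : sgraph).

Definition activation_step : rel {set G} := fun S S' =>
  [exists v : G, (t <= #|nbhd v :&: S|) && (S' == v |: S)].

(* [connect] is the reflexive transitive closure, so this says that some finite
   sequence of activations leads from D to the whole vertex set. Activations
   never disable one another, so their order is irrelevant. *)
Definition dynamic_monopoly (D : {set G}) : bool :=
  connect activation_step D [set: G].

(* The default [set: G] is itself a dynamic monopoly (zero steps), so the
   minimum is over a nonempty family. *)
Definition dyn : nat :=
  #|[arg min_(D < [set: G] | dynamic_monopoly D) #|D|]|.

Definition minimum_dynamic_monopoly (D : {set G}) : Prop :=
  dynamic_monopoly D /\
  forall D' : {set G}, dynamic_monopoly D' -> #|D| <= #|D'|.

End DynamicMonopolies.

(* Main.v *)
Require Import Defs.
From mathcomp Require Import all_boot all_order all_algebra.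
From mathcomp Require Import zify lra.
Import Order.TTheory GRing.Theory Num.Theory.
Local Open Scope ring_scope.

(** Split [D_H] as [A] and [B] so that every vertex of [B] has a neighbour in
    [A] and [2 |B| >= |D_H|]: take a maximal independent set of [H[D_H]] or its
    complement, since without isolated vertices each dominates the other. Fix
    [u0] in a minimum monopoly [D_G] of [G]. Then [D_G x D_H] minus [{u0} x B]
    is a monopoly of the product. For [w] in [A] the copy [G x {w}] contains all
    of [D_G], hence fills up. For [v] in [B] with neighbour [w] in [A], run the
    process of [G] on [G x {v}]: a vertex [(x, v)] that misses its neighbour
    [(u0, v)] gains the active neighbour [(x, w)] instead, so everything but
    [(u0, v)] is activated, and finally [(u0, v)] itself, its degree in [G] being
    at least [t]. Now [G x D_H] is active and every copy of [H] fills up. *)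

Set Implicit Arguments.
Unset Strict Implicit.

(** The sets at which the activation process is stuck. Arguing with them replaces the handling of
    activation sequences in the product. *)
Definition closed_set (t : nat) (G : sgraph) (S : {set G}) : Prop :=
  forall v : G, (t <= #|nbhd v :&: S|)%N -> v \in S.

Lemma activation_sub (t : nat) (G : sgraph) (D E S : {set G}) :
  connect (activation_step t (G := G)) D E -> closed_set t S ->
  D \subset S -> E \subset S.
Proof.
move=> /connectP[p pathp ->] clS; elim: p D pathp => [//|F p IHp] D /=.
move=> /andP[/existsP[v /andP[vD /eqP ->]] pathp] DS; apply: IHp pathp _.
rewrite subUset DS sub1set andbT; apply: clS.
by apply: leq_trans vD _; apply/subset_leq_card/setIS.
Qed.

(** A closed set containing [D] absorbs every activation. Conversely, a largest set reachable from
    [D] is closed, as a further activation would enlarge it. *)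
Lemma dynamic_monopolyP (t : nat) (G : sgraph) (D : {set G}) :
  dynamic_monopoly t D <->
  (forall S : {set G}, closed_set t S -> D \subset S -> S = [set: G]).
Proof.
split=> [dynD S clS DS|fullD].
  by apply/eqP; rewrite eqEsubset subsetT (activation_sub dynD).
case: (@arg_maxnP _ D (connect (activation_step t (G := G)) D)
         (fun S : {set G} => #|S|) (connect0 _ D)) => M DM maxM.
suff E : M = [set: G] by rewrite /dynamic_monopoly -E.
apply: fullD => [v vM|].
  have /maxM : connect (activation_step t (G := G)) D (v |: M).
    apply: connect_trans DM (connect1 _).
    by apply/existsP; exists v; rewrite vM eqxx.
  by rewrite /= cardsU1; case: (v \in M) => //=; rewrite add1n ltnn.
(* Activations only add vertices, so [D] stays inside [M]. *)
have /connectP[p pathp ->] := DM; elim: p (D) pathp => [//|F p IHp] E /=.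
move=> /andP[/existsP[v /andP[_ /eqP ->]] /IHp]; apply: subset_trans.
exact: subsetUr.
Qed.

Lemma dyn_le_card (t : nat) (G : sgraph) (D : {set G}) :
  dynamic_monopoly t D -> (dyn t G <= #|D|)%N.
Proof.
move=> dynD; rewrite /dyn; case: arg_minnP => [|E _]; first exact: connect0.
exact.
Qed.

Lemma dyn_witness (t : nat) (G : sgraph) :
  exists2 D : {set G}, dynamic_monopoly t D & #|D| = dyn t G.
Proof.
rewrite /dyn; case: arg_minnP => [|E dynE _]; first exact: connect0.
by exists E.
Qed.

Lemma minimum_dynamic_monopoly_card (t : nat) (G : sgraph) (D : {set G}) :
  minimum_dynamic_monopoly t D -> #|D| = dyn t G.
Proof.
case=> dynD minD; apply/eqP; rewrite eqn_leq dyn_le_card // andbT.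
by have [E dynE <-] := dyn_witness t G; apply: minD.
Qed.

(** For a positive threshold the empty set is closed. This provides the vertex [u] of the monopoly
    of [G]. *)
Lemma dynamic_monopoly_neq0 (t : nat) (G : sgraph) (D : {set G}) :
  (0 < t)%N -> (0 < #|G|)%N -> dynamic_monopoly t D -> D != set0.
Proof.
move=> t_gt0 G_gt0 /dynamic_monopolyP fullD; apply/eqP => D0.
suff /fullD E : closed_set t (set0 : {set G}).
  by move: G_gt0; rewrite -cardsT -E ?cards0 // D0.
by move=> v; rewrite setI0 cards0 leqNgt t_gt0.
Qed.

Lemma nonisolated_induced (G : sgraph) (D : {set G}) :
  (forall v : induced D, ~~ isolated v) ->
  forall v, v \in D -> exists2 w, w \in D & adj v w.
Proof.
move=> noiso v vD; have := noiso (Sub v vD : induced D).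
rewrite /isolated /degree -lt0n => /card_gt0P[w]; rewrite inE => vw.
by exists (val w); first exact: valP w.
Qed.

Lemma dominated_half (G : sgraph) (D : {set G}) :
  (forall v, v \in D -> exists2 w, w \in D & adj v w) ->
  exists B : {set G}, [/\ B \subset D, (#|D| <= 2 * #|B|)%N &
    forall v, v \in B -> exists2 w, w \in D :\: B & adj v w].
Proof.
move=> noiso.
pose indep (A : {set G}) :=
  (A \subset D) && [forall x in A, forall y in A, ~~ adj x y].
have indepP (A : {set G}) : reflect (A \subset D /\ {in A &, forall x y, ~~ adj x y})
                        (indep A).
  apply: (iffP andP) => -[AD indA]; split=> //.
    by move=> x y xA yA; have/forall_inP/(_ x xA)/forall_inP/(_ y yA) := indA.
  apply/forall_inP => x xA; apply/forall_inP => y yA; exact: indA.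
have indep0 : indep set0.
  by apply/indepP; split=> [|x y]; [exact: sub0set | rewrite inE].
have [A maxA _] := maxset_exists indep0.
have /maxsetP[/indepP[AD indA] Amax] := maxA.
have domA v : v \in D :\: A -> exists2 w, w \in A & adj v w.
  rewrite inE => /andP[vA vD]; apply/exists_inP; apply: contraT => /exists_inPn nvA.
  (* A vertex without neighbours in [A] could be added to [A], against maximality. *)
  suff indvA : indep (v |: A).
    by move: vA; rewrite -(Amax _ indvA (subsetUr _ _)) setU11.
  apply/indepP; split=> [|x y]; first by rewrite subUset sub1set vD.
  rewrite !inE => /orP[/eqP->|xA] /orP[/eqP->|yA].
  - by rewrite adj_irrefl.
  - exact: nvA.
  - by rewrite adj_sym; apply: nvA.
  - exact: indA.
have domC v : v \in A -> exists2 w, w \in D :\: A & adj v w.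
  move=> vA; have [w wD vw] := noiso v (subsetP AD v vA).
  by exists w => //; rewrite inE wD andbT; apply: contraL vw; apply: indA.
have cardD := cardsID A D; rewrite (setIidPr AD) in cardD.
(* [B] is whichever of [A] and [D :\: A] has at least half of [D]; the other one dominates it. *)
have [hA|/ltnW hA] := leqP #|D| (2 * #|A|).
  by exists A.
exists (D :\: A); split; [exact: subsetDl | lia | move=> v /domA[w wA vw]].
by exists w; rewrite // setDDr setDv set0U inE wA (subsetP AD).
Qed.

Section ClosedSetsOfProduct.

Variables (G H : sgraph) (t : nat) (S : {set G □ H}).
Hypothesis clS : closed_set t S.

Let row (v : H) : {set G} := [set x | ((x, v) : G □ H) \in S].
Let col (x : G) : {set H} := [set v | ((x, v) : G □ H) \in S].

Lemma row_nbhd_sub (x : G) (v : H) :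
  [set ((y, v) : G □ H) | y in nbhd x :&: row v] \subset
    nbhd ((x, v) : G □ H) :&: S.
Proof.
apply/subsetP => _ /imsetP[y + ->]; rewrite !inE => /andP[xy yS].
by rewrite yS andbT /= /cart_adj /= xy eqxx orbT.
Qed.

(** Neighbours of [x] in the row inject into the neighbours of [(x, v)] in [S]. *)
Lemma closed_row (v : H) : closed_set t (row v).
Proof.
move=> x tx; rewrite inE; apply: clS; apply: leq_trans tx _.
rewrite -(card_imset _ (f := fun y => (y, v) : G □ H)) => [|y z [] //].
exact: subset_leq_card (row_nbhd_sub x v).
Qed.

Lemma closed_col (x : G) : closed_set t (col x).
Proof.
move=> v tv; rewrite inE; apply: clS; apply: leq_trans tv _.
rewrite -(card_imset _ (f := fun w => (x, w) : G □ H)) => [|y z [] //].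
apply/subset_leq_card/subsetP => _ /imsetP[y + ->].
by rewrite !inE => /andP[vy yS]; rewrite yS andbT /= /cart_adj /= vy eqxx.
Qed.

(** Pretending that [u] is active adds at most one to the count of any [x], and the active neighbour
    [(x, w)], which lies outside row [v], makes up for it. *)
Lemma closed_row_add (u : G) (v w : H) :
  adj v w -> row w = [set: G] -> closed_set t (u |: row v).
Proof.
move=> vw roww x tx; rewrite inE; apply/orP; right; rewrite inE.
apply: clS; apply: leq_trans tx _.
have wv : w != v by apply: contraTneq vw => ->; rewrite adj_irrefl.
apply: (@leq_trans (#|nbhd x :&: row v|).+1).
  rewrite setIUr -add1n; apply: leq_trans (leq_card_setU _ _) _.
  by rewrite leq_add2r -(cards1 u) subset_leq_card // subsetIr.
pose I := [set ((y, v) : G □ H) | y in nbhd x :&: row v].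
have cardI : #|I| = #|nbhd x :&: row v| by apply: card_imset => y z [].
have xwI : ((x, w) : G □ H) \notin I.
  by apply/imsetP => -[y _ [_ wvE]]; rewrite wvE eqxx in wv.
have := cardsU1 ((x, w) : G □ H) I; rewrite xwI cardI add1n => <-.
apply: subset_leq_card; rewrite subUset row_nbhd_sub sub1set !inE andbT.
rewrite /= /cart_adj /= eqxx vw /=.
by have := in_setT x; rewrite -roww inE.
Qed.

End ClosedSetsOfProduct.

Lemma cart_prod_monopoly (G H : sgraph) (t : nat) (DG : {set G}) (DH B : {set H})
    (u : G) :
  (forall v : G, (t <= degree v)%N) ->
  dynamic_monopoly t DG -> dynamic_monopoly t DH ->
  (forall v, v \in B -> exists2 w, w \in DH :\: B & adj v w) ->
  dynamic_monopoly t
    (setX DG DH :\: setX [set u] B : {set G □ H}).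
Proof.
move=> degG /dynamic_monopolyP fullG /dynamic_monopolyP fullH domB.
apply/dynamic_monopolyP => S clS /subsetP DS.
have rowA w : w \in DH :\: B -> [set x | ((x, w) : G □ H) \in S] = [set: G].
  rewrite inE => /andP[wB wD]; apply: fullG; first exact: closed_row.
  apply/subsetP => x xD; rewrite inE; apply: DS.
  by rewrite !inE /= xD wD (negPf wB) andbF.
have rowD v : v \in DH -> [set x | ((x, v) : G □ H) \in S] = [set: G].
  move=> vD; have [vB|vB] := boolP (v \in B); last by rewrite rowA // inE vB.
  have [w wA vw] := domB v vB.
  have rowU : u |: [set x | ((x, v) : G □ H) \in S] = [set: G].
    apply: fullG; first exact: closed_row_add vw (rowA w wA).
    apply/subsetP => x xD; rewrite !inE; have [//|xu /=] := eqVneq x u.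
    by apply: DS; rewrite !inE /= xD vD (negPf xu).
  suff uS : u \in [set x | ((x, v) : G □ H) \in S].
    by rewrite -rowU; apply/esym/setUidPr; rewrite sub1set.
  (* [rowU] puts every vertex except possibly [u] in the row, and [u] is not its own neighbour, so
     all neighbours of [u] are active. *)
  apply: (closed_row clS).
  apply: leq_trans (degG u) _; apply/subset_leq_card/subsetP => y uy.
  rewrite inE uy /=; have := in_setT y; rewrite -rowU in_setU1 => /orP[/eqP yu|//].
  by move: uy; rewrite yu /nbhd !inE adj_irrefl.
apply/setP => -[x v]; rewrite in_setT.
suff colx : [set w | ((x, w) : G □ H) \in S] = [set: H].
  by have := in_setT v; rewrite -colx inE.
apply: fullH; first exact: closed_col.
by apply/subsetP => w /rowD E; have := in_setT x; rewrite -E !inE.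
Qed.

Unset Implicit Arguments.
Set Strict Implicit.

Theorem theorem12 (G H : sgraph) (t : nat)
  (G_nonempty : (0 < #|G|)%N)
  (t_ge3 : (3 <= t)%N)
  (degG : forall v : G, (t <= degree v)%N)
  (degH : forall v : H, (t <= degree v)%N)
  (dyn_le : (dyn t G <= dyn t H)%N)
  (D_H : {set H})
  (D_H_min : minimum_dynamic_monopoly t D_H)
  (D_H_noiso : forall v : induced D_H, ~~ isolated v) :
  (dyn t (G □ H))%:R <=
    (dyn t G)%:R * (dyn t H)%:R - 1 / 2%:R * (dyn t H)%:R :> rat.
Proof.
have [DG dynDG cardG] := dyn_witness t G.
have cardH := minimum_dynamic_monopoly_card D_H_min.
have [B [BD cardB domB]] := dominated_half (nonisolated_induced D_H_noiso).
have [u uD] : exists u, u \in DG.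
  by apply/set0Pn; apply: dynamic_monopoly_neq0 dynDG; first exact: ltn_trans t_ge3.
have := dyn_le_card (cart_prod_monopoly u degG dynDG D_H_min.1 domB).
have sub : setX [set u] B \subset setX DG D_H.
  apply/subsetP => -[x v]; rewrite !inE /= => /andP[/eqP-> /(subsetP BD) ->].
  by rewrite uD.
rewrite cardsD (setIidPr sub) !cardsX cards1 mul1n cardG cardH => dyn_prod.
(* This bound ensures that the natural-number subtraction in [dyn_prod] does not truncate. *)
have := subset_leq_card sub; rewrite !cardsX cards1 mul1n cardG cardH => leB.
(* Doubling clears the factor one half, so the estimate is settled in [nat] before the cast to
   [rat]. *)
have {dyn_prod leB} : (2 * dyn t (G □ H) + dyn t H <= 2 * (dyn t G * dyn t H))%N.
  rewrite cardH in cardB; lia.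
rewrite -(ler_nat rat) natrD !natrM; lra.
Qed.
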